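(* Fix a prime power $q$, positive integers $r,\delta$, and an integer $\kappa_B$ which is an upper bound on the dimension of linear codes over $\mathbb{F}_q$ of length $r+\delta-1$ and minimum distance at least $\delta$. Then, for linear $(n,k,d,r,\delta)$-LRCs over $\mathbb{F}_q$ with rate $\mathcal{R}=k/n$ and relative minimum distance $\delta_n=d/n$, $$\mathcal{R}\le\frac{\kappa_B}{\mathcal{G}(\kappa_B,\delta)}\,(1-\delta_n)+o(1)\qquad (n\to\infty),$$ where the $o(1)$ term depends only on $n,q,r,\delta,\kappa_B$ and tends to $0$ as $n\to\infty$.
   Context: $[n]=\{1,\dots,n\}$. An $(n,k,d,r,\delta)$-LRC over $\mathbb{F}_q$ is a linear code of length $n$, dimension $k\ge1$ and minimum distance $d$ over $\mathbb{F}_q$ such that for every $i\in[n]$ there is a set $R\subseteq[n]$ with $i\in R$, $|R|\le r+\delta-1$, and the restriction $\mathcal{C}|_R=\{\mathbf{c}_R:\mathbf{c}\in\mathcal{C}\}$ having minimum distance at least $\delta$ (the zero code is regarded as having infinite minimum distance). Griesmer function over $\mathbb{F}_q$: $\mathcal{G}(k,d)=\sum_{i=0}^{k-1}\lceil d/q^i\rceil$. *)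

(* Defs.v *)
From mathcomp Require Import all_boot all_order all_algebra all_field.

Set Implicit Arguments.
Unset Strict Implicit.
Unset Printing Implicit Defensive.

Import Order.TTheory GRing.Theory Num.Theory.

Local Open Scope ring_scope.

Definition prime_power (q : nat) : Prop :=
  exists p m : nat, [/\ prime p, (0 < m)%N & q = (p ^ m)%N].

Definition hamming_dist (F : finFieldType) (n : nat) (u v : 'rV[F]_n) : nat :=
  #|[set i : 'I_n | u 0 i != v 0 i]|.

(* A linear code of length n over F is a subspace of 'rV[F]_n.  The condition
   below holds vacuously for the zero code, whose minimum distance is thus
   treated as infinite. *)
Definition min_dist_ge (F : finFieldType) (n : nat) (C : {vspace 'rV[F]_n})
    (d : nat) : Prop :=
  forall u v, u \in C -> v \in C -> u != v -> (d <= hamming_dist u v)%N.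

(* Never satisfied by the zero code. *)
Definition has_min_dist (F : finFieldType) (n : nat) (C : {vspace 'rV[F]_n})
    (d : nat) : Prop :=
  min_dist_ge C d /\
  exists u v, [/\ u \in C, v \in C, u != v & hamming_dist u v = d].

(* C|_R, as a code of length #|R|: the coordinates in R are listed in
   increasing order by enum_val. *)
Definition restriction (F : finFieldType) (n : nat) (C : {vspace 'rV[F]_n})
    (R : {set 'I_n}) : {vspace 'rV[F]_#|R|} :=
  (linfun (colsub (fun j : 'I_#|R| => enum_val j)) @: C)%VS.

(* C is an (n, k, d, r, delta)-LRC; the length n is carried by the type of C. *)
Definition is_LRC (F : finFieldType) (n : nat) (C : {vspace 'rV[F]_n})
    (k d r delta : nat) : Prop :=
  [/\ \dim C = k,
      (0 < k)%N,
      has_min_dist C d &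
      forall i : 'I_n, exists R : {set 'I_n},
        [/\ i \in R, (#|R| <= r + delta - 1)%N &
            min_dist_ge (restriction C R) delta]].

(* The field with q elements is only unique up to isomorphism, hence the
   quantification over all its models. *)
Definition dim_upper_bound (q m d kappa : nat) : Prop :=
  forall (F : finFieldType) (C : {vspace 'rV[F]_m}),
    #|F| = q -> min_dist_ge C d -> (\dim C <= kappa)%N.

Definition griesmer (q k d : nat) : int :=
  \sum_(i < k) Num.ceil (d%:R / q%:R ^+ i : rat).

(* Main.v *)
(** A code of dimension [s] and distance [delta] has length at least
    [griesmer s delta] (residual codes), and [griesmer s delta / s] is
    nonincreasing in [s].  Let [D] be the subcode of [C] vanishing on a set [U]
    of coordinates.  As long as [D] is nonzero, some recovery set [R] meets its
    support; then [D] restricted to [R :\: U] has dimension [0 < s <= kappaB]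
    and distance at least [delta], so replacing [U] by [U :|: R] adds at least
    [griesmer s delta >= s * griesmer kappaB delta / kappaB] coordinates and
    lowers the dimension of [D] by [s].  Stopping when
    [0 < \dim D <= kappaB], a nonzero word of [D] gives [d <= n - #|U|], hence
    [k <= kappaB / griesmer kappaB delta * (n - d) + kappaB]. *)
Require Import Defs.
From mathcomp Require Import all_boot all_order all_algebra all_field.
From mathcomp Require Import all_classical all_reals all_analysis.
From mathcomp Require Import zify ring.

Set Implicit Arguments.
Unset Strict Implicit.
Unset Printing Implicit Defensive.

Import Order.TTheory GRing.Theory Num.Theory.
Import numFieldNormedType.Exports.

Local Open Scope ring_scope.

(** * Weights, restriction and shortening of codes *)

Definition weight_on (F : finFieldType) (n : nat) (S : {set 'I_n})
    (c : 'rV[F]_n) : nat :=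
  #|[set i in S | c 0 i != 0]%SET|.

Definition weight (F : finFieldType) (n : nat) (c : 'rV[F]_n) : nat :=
  #|[set i | c 0 i != 0]%SET|.

Definition coord_map (F : finFieldType) (n : nat) (S : {set 'I_n}) :
    'Hom('rV[F]_n, 'rV[F]_#|S|) :=
  linfun (colsub (fun j : 'I_#|S| => enum_val j)).

(** The zero coordinates are kept, so a shortened code still has length [n] and can be shortened
    again on a larger set. *)
Definition shorten (F : finFieldType) (n : nat) (C : {vspace 'rV[F]_n})
    (S : {set 'I_n}) : {vspace 'rV[F]_n} :=
  (C :&: lker (coord_map F S))%VS.

Lemma coord_mapE (F : finFieldType) (n : nat) (S : {set 'I_n})
    (c : 'rV[F]_n) j :
  coord_map F S c 0 j = c 0 (enum_val j).
Proof. by rewrite lfunE /= mxE. Qed.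

Lemma coord_map_eq0 (F : finFieldType) (n : nat) (S : {set 'I_n})
    (c : 'rV[F]_n) :
  reflect (forall i, i \in S -> c 0 i = 0) (coord_map F S c == 0).
Proof.
apply: (iffP eqP) => [c0 i iS|c0].
  by rewrite -(enum_rankK_in iS iS) -coord_mapE c0 mxE.
by apply/rowP => j; rewrite coord_mapE mxE c0 // enum_valP.
Qed.

Lemma mem_shorten (F : finFieldType) (n : nat) (C : {vspace 'rV[F]_n})
    (S : {set 'I_n}) (c : 'rV[F]_n) :
  (c \in shorten C S) = (c \in C) && (coord_map F S c == 0).
Proof. by rewrite memv_cap memv_ker. Qed.

Lemma hamming_distB (F : finFieldType) (n : nat) (u v : 'rV[F]_n) :
  hamming_dist u v = weight (u - v).
Proof.
by apply: eq_card => i; rewrite !inE !mxE subr_eq0.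
Qed.

Lemma min_dist_geP (F : finFieldType) (n : nat) (C : {vspace 'rV[F]_n}) d :
  min_dist_ge C d <->
  forall c, c \in C -> c != 0 -> (d <= weight c)%N.
Proof.
split=> [h c cC c0|h u v uC vC uv].
  have := h c 0 cC (mem0v C) c0.
  by rewrite hamming_distB subr0.
by rewrite hamming_distB; apply: h; rewrite ?memvB // subr_eq0.
Qed.

Lemma weight_rmap (F : finFieldType) (n : nat) (S : {set 'I_n})
    (c : 'rV[F]_n) :
  weight (coord_map F S c) = weight_on S c.
Proof.
rewrite /weight /weight_on -(card_imset _ (@enum_val_inj _ (mem S))).
apply: eq_card => i; apply/imsetP/idP => [[j jS ->]|].
  by move: jS; rewrite !inE coord_mapE /= => ->; rewrite enum_valP.
rewrite inE => /andP[iS ci]; exists (enum_rank_in iS i).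
  by rewrite !inE coord_mapE enum_rankK_in.
by rewrite enum_rankK_in.
Qed.

Lemma min_dist_restrictionP (F : finFieldType) (n : nat)
    (C : {vspace 'rV[F]_n}) (S : {set 'I_n}) d :
  min_dist_ge (restriction C S) d <->
  forall c, c \in C -> coord_map F S c != 0 -> (d <= weight_on S c)%N.
Proof.
rewrite min_dist_geP; split=> [h c cC c0|h _ /memv_imgP[c cC ->] c0].
  by rewrite -weight_rmap; apply: h => //; apply: memv_img.
by have := h c cC c0; rewrite -weight_rmap; apply.
Qed.

Lemma dim_restriction (F : finFieldType) (n : nat)
    (C : {vspace 'rV[F]_n}) (S : {set 'I_n}) :
  (\dim (shorten C S) + \dim (restriction C S))%N = \dim C.
Proof. exact: limg_ker_dim. Qed.

Lemma weight_onC (F : finFieldType) (n : nat) (S : {set 'I_n})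
    (c : 'rV[F]_n) :
  (weight_on S c + weight_on (~: S) c)%N = weight c.
Proof.
rewrite /weight /weight_on -(cardsID S [set i | c 0 i != 0]%SET).
by congr (_ + _)%N; apply: eq_card => i; rewrite !inE // andbC.
Qed.

(** Padding with [p] zero coordinates is injective and preserves weights. The lemma serves for the
    sets [R :\: U], which may have fewer than [r + delta - 1] elements. *)
Lemma dim_upper_bound_leq q m m' d kappa :
  (m' <= m)%N -> dim_upper_bound q m d kappa -> dim_upper_bound q m' d kappa.
Proof.
move=> /subnKC <-; set p := (m - m')%N => h F C Fq Cd.
pose f : 'Hom('rV[F]_m', 'rV[F]_(m' + p)) := linfun (mulmxr (row_mx 1%:M 0)).
have fE u : f u = row_mx u 0.
  by rewrite lfunE /= mul_mx_row mulmx1 mulmx0.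
have kf : (lker f == 0)%VS.
  apply/lker0P => u v; rewrite !fE => /eq_row_mx[] //.
rewrite -(limg_dim_eq (_ : (C :&: lker f = 0)%VS)); last first.
  by rewrite (eqP kf) capv0.
apply: h Fq _; apply/min_dist_geP => _ /memv_imgP[c cC ->].
rewrite fE row_mx_eq0 eqxx andbT => c0.
apply: leq_trans ((min_dist_geP _ _).1 Cd c cC c0) _.
rewrite /weight -(card_imset _ (@lshift_inj m' p)); apply: subset_leq_card.
apply/fintype.subsetP => _ /imsetP[i + ->]; rewrite !inE /= row_mxEl //.
Qed.

(** * The Griesmer bound and the function [griesmer] *)

(* Each coordinate of [supp c] vanishes in [u + a c] for exactly one scalar [a],
   so averaging over [a] leaves at most the fraction [1 - 1/q] of it. *)
Lemma small_translate (F : finFieldType) (n : nat) (c u : 'rV[F]_n) :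
  let S := [set i | c 0 i != 0]%SET in
  exists a : F, (#|F| * weight_on S (u + a *: c) + #|S| <= #|F| * #|S|)%N.
Proof.
have q0 : (0 < #|F|)%N by apply/card_gt0P; exists 0.
move=> S; apply/existsP; apply: contraT; rewrite negb_exists => /forallP h.
have tot : (\sum_(a : F) (weight_on S (u + a *: c)) + #|S| = #|F| * #|S|)%N.
  have -> : (\sum_(a : F) weight_on S (u + a *: c) =
             \sum_(i in S) #|[set a : F | ((u + a *: c) 0 i != 0)%R]%SET|)%N.
    transitivity (\sum_(a : F)
        \sum_(i in [set i in S | ((u + a *: c) 0 i != 0)%R]%SET) 1)%N.
      by apply: eq_bigr => a _; rewrite sum1_card.
    rewrite (exchange_big_dep (mem S)) /=.
      apply: eq_bigr => i iS; rewrite -sum1_card; apply: eq_bigl => a.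
      by rewrite !inE in iS *; rewrite iS.
    by move=> a i _; rewrite !inE => /andP[].
  rewrite mulnC -sum_nat_const -[X in (_ + X)%N]sum1_card -big_split /=.
  apply: eq_bigr => i.
  rewrite inE => ci.
  have -> : [set a : F | (u + a *: c) 0 i != 0]%SET =
             [set~ - u 0 i / c 0 i]%SET.
    apply/finset.setP => a; rewrite !inE !mxE; congr (~~ _).
    by rewrite addrC addr_eq0 -(can2_eq (mulfK ci) (divfK ci)).
  by rewrite cardsC1 addn1 prednK.
have : (\sum_(a : F) (#|F| * #|S|).+1 <=
        \sum_(a : F) (#|F| * weight_on S (u + a *: c) + #|S|))%N.
  by apply: leq_sum => a _; rewrite ltnNge h.
rewrite big_split /= -big_distrr /= !sum_nat_const -mulnDr tot mulnS.
by rewrite -[X in (_ <= X)%N]add0n leq_add2r leqNgt q0.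
Qed.

(** The term of index 0 is [d], and each later term satisfies [d / q^(i+1) <= t / q^i]. *)
Lemma griesmerS_le q s d t : (0 < q)%N -> (d <= q * t)%N ->
  griesmer q s.+1 d <= d%:Z + griesmer q s t.
Proof.
move=> q0 dqt; rewrite /griesmer big_ord_recl expr0 divr1.
have -> : Num.ceil (d%:R : rat) = d%:Z by rewrite -(intrKceil (R := rat) d%:Z).
rewrite lerD2l; apply: ler_sum => i _; apply: ceil_le.
rewrite /= exprSr invfM mulrA mulrAC ler_pM2r ?invr_gt0 ?exprn_gt0 ?ltr0n //.
by rewrite ler_pdivrMr ?ltr0n // -natrM ler_nat mulnC.
Qed.

(** The terms of the Griesmer sum are nonincreasing, so the average of the first [s] is at least the
    average of the first [kappa]. In the induction, the new term [a] is at most each of the first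
    [s] terms. *)
Lemma griesmer_ratio q s kappa d : (0 < q)%N -> (s <= kappa)%N ->
  s%:Z * griesmer q kappa d <= kappa%:Z * griesmer q s d.
Proof.
move=> q0; elim: kappa => [|k IH]; first by rewrite leqn0 => /eqP ->.
rewrite leq_eqVlt => /orP[/eqP <- //|]; rewrite ltnS => sk.
have {IH} := IH sk; rewrite /griesmer big_ord_recr /=.
set a := Num.ceil _; set G := \sum_(i < k) _; set G' := \sum_(i < s) _ => IH.
suff : s%:Z * a <= G' by lia.
have -> : s%:Z * a = \sum_(i < s) a.
  by rewrite sumr_const card_ord -mulr_natl natz.
apply: ler_sum => i _; apply: ceil_le.
rewrite ler_wpM2l // lef_pV2 ?posrE ?exprn_gt0 ?ltr0n //.
by rewrite ler_weXn2l // ?ler1n // ltnW // (leq_trans (ltn_ord i)).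
Qed.

Lemma griesmer_gt0 q kappa d : (0 < kappa)%N -> (0 < d)%N ->
  0 < griesmer q kappa d.
Proof.
case: kappa => // k _ d0; rewrite /griesmer big_ord_recl expr0 divr1.
apply: ltr_wpDr.
  apply: sumr_ge0 => i _.
  by rewrite ceil_ge0 // (lt_le_trans (ltrN10 _)) // divr_ge0 ?exprn_ge0.
by rewrite ceil_gt0 ltr0n.
Qed.

(** Induction on the dimension: for a nonzero word [c] of least weight [w], restricting [C] to the
    zeros of [c] loses only the line of [c] and leaves distance at least [w / #|F|]. *)
Lemma griesmer_bound (F : finFieldType) (n : nat) (C : {vspace 'rV[F]_n}) d :
  min_dist_ge C d -> griesmer #|F| (\dim C) d <= n%:Z.
Proof.
have q0 : (0 < #|F|)%N by apply/card_gt0P; exists 0.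
move: {2}(\dim C) (erefl (\dim C)) => s.
elim: s n C d => [|s IH] n C d dimC /min_dist_geP Cd.
  by rewrite dimC /griesmer big_ord0.
have C0 : vpick C != 0 by rewrite vpick0 -dimv_eq0 dimC.
pose P (c : 'rV[F]_n) := (c \in C) && (c != 0).
have P0 : P (vpick C) by rewrite /P memv_pick C0.
case: (@arg_minnP _ _ P (@weight F n) P0) => c /andP[cC c0] cmin.
set w := weight c in cmin.
(* Since [d] is only a lower bound for the distance, the residual argument runs with the true
   minimum [w]. *)
have dw : (d <= w)%N by apply: Cd.
pose S := [set i | c 0 i != 0]%SET.
have wS : #|S| = w by apply: eq_card => i; rewrite !inE.
have w0 : (0 < w)%N.
  rewrite -wS card_gt0; apply: contra_neq c0 => S0; apply/rowP => i.
  by have := finset.in_set0 i; rewrite -S0 inE mxE => /negbFE/eqP.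
(* Some [u + a *: c] has weight at most [w - w / #|F|] on [S]. If it is nonzero, its total weight is
   at least [w], so the rest lies off [S], where it agrees with [u]. *)
have resid u : u \in C -> (exists a, u = a *: c) \/
    (w <= #|F| * weight_on (~: S) u)%N.
  move=> uC; have [a] := small_translate c u; rewrite -/S wS => ha.
  case: (eqVneq (u + a *: c) 0) => [/eqP|n0].
    by rewrite addr_eq0 -scaleNr => /eqP ->; left; exists (- a).
  right; have /cmin : P (u + a *: c) by rewrite /P n0 andbT memvD ?memvZ.
  rewrite -(weight_onC S).
  have -> : weight_on (~: S) (u + a *: c) = weight_on (~: S) u.
    apply: eq_card => i; rewrite !inE negbK !mxE.
    by case: eqP => //= ->; rewrite mulr0 addr0.
  rewrite -(leq_pmul2l q0) mulnDr => /(leq_trans ha).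
  by rewrite leq_add2l.
have kerS : shorten C (~: S) = <[c]>%VS.
  apply/vspaceP => u; rewrite mem_shorten; apply/andP/idP.
    move=> [uC /coord_map_eq0 u0]; case: (resid u uC) => [[a ->]|].
      by rewrite memvZ // memv_line.
    suff -> : weight_on (~: S) u = 0%N by rewrite muln0 leqNgt w0.
    apply/eqP; rewrite cards_eq0; apply/eqP/finset.setP => i.
    rewrite finset.in_set0 inE; case: (boolP (i \in _)) => //= /u0 ->.
    by rewrite eqxx.
  move=> /vlineP[a ->]; rewrite memvZ //; split=> //; apply/coord_map_eq0 => i.
  by rewrite !inE negbK mxE => /eqP ->; rewrite mulr0.
have dimR : \dim (restriction C (~: S)) = s.
  by have := dim_restriction C (~: S); rewrite kerS dim_vline c0 dimC => -[].
(* This is the ceiling of [w / #|F|]. *)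
pose t := ((w + #|F|.-1) %/ #|F|)%N.
have wt : (w <= #|F| * t)%N.
  have := ltn_ceil (w + #|F|.-1) q0; rewrite -/t; nia.
have Rt : min_dist_ge (restriction C (~: S)) t.
  apply/min_dist_restrictionP => u uC u0; case: (resid u uC) => [[a ua]|].
    case/coord_map_eq0: u0 => i; rewrite !inE negbK ua mxE => /eqP ->.
    by rewrite mulr0.
  by move=> wu; rewrite -ltnS /t ltn_divLR // mulnC mulnS; lia.
have := IH _ _ _ dimR Rt; rewrite dimR dimC => IHs.
apply: le_trans (griesmerS_le s q0 (leq_trans dw wt)) _.
have dw' : d%:Z <= w%:Z by rewrite lez_nat.
apply: le_trans (lerD dw' IHs) _.
by rewrite -wS -PoszD cardsC card_ord.
Qed.

(** * Greedy enlargement of the vanishing set *)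

Lemma LRC_step (F : finFieldType) (n k d r delta kappa : nat)
    (C : {vspace 'rV[F]_n}) (U : {set 'I_n}) :
  dim_upper_bound #|F| (r + delta - 1) delta kappa ->
  is_LRC C k d r delta -> (0 < \dim (shorten C U))%N ->
  exists V : {set 'I_n}, exists s : nat,
    [/\ (0 < s <= kappa)%N, \dim (shorten C U) = (\dim (shorten C V) + s)%N &
        griesmer #|F| s delta + #|U|%:Z <= #|V|%:Z].
Proof.
move=> hk [_ _ _ loc] D0.
set D := shorten C U in D0 *.
have c0 : vpick D != 0 by rewrite vpick0 -dimv_eq0 -lt0n.
have cD := memv_pick D; set c := vpick D in c0 cD.
have [i ci] : exists i, c 0 i != 0 by apply/rV0Pn.
have [R [iR Rm Rd]] := loc i.
pose T := R :\: U.
have Dsub u : u \in D -> u \in C /\ forall j, j \in U -> u 0 j = 0.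
  by rewrite mem_shorten => /andP[uC /coord_map_eq0].
have Td : min_dist_ge (restriction D T) delta.
  apply/min_dist_restrictionP => u /Dsub[uC uU] uT.
  (* Words of [D] vanish on [U], so passing from [R] to [R :\: U] loses no weight. *)
  have -> : weight_on T u = weight_on R u.
    apply: eq_card => j; rewrite !inE.
    by case: (boolP (j \in U)) => //= /uU ->; rewrite eqxx andbF.
  apply: ((min_dist_restrictionP C R delta).1 Rd u uC).
  apply: contraNN uT => /coord_map_eq0 uR; apply/coord_map_eq0 => j.
  by rewrite inE => /andP[_ /uR].
have VE : shorten D T = shorten C (U :|: R).
  apply/vspaceP => u; rewrite /D !mem_shorten -andbA; congr (_ && _).
  apply/andP/coord_map_eq0 => [[/coord_map_eq0 uU /coord_map_eq0 uT] j|h].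
    rewrite inE; case: (boolP (j \in U)) => [/uU //|jU /= jR].
    by apply: uT; rewrite inE jU.
  by split; apply/coord_map_eq0 => j; [move=> jU|rewrite inE => /andP[_ jR]];
    apply: h; rewrite inE ?jU ?jR ?orbT.
exists (U :|: R), (\dim (restriction D T)); split.
- apply/andP; split.
    (* The word [c] of [D] is nonzero at [i], which lies in [R] and, as [c] vanishes on [U], outside
       [U]. *)
    rewrite lt0n dimv_eq0; apply: contraNneq ci => T0.
    have : coord_map F T c \in restriction D T by apply: memv_img.
    rewrite T0 memv0 => /coord_map_eq0 cT; have [_ cU] := Dsub c cD.
    by case: (boolP (i \in U)) => [/cU ->|iU]; rewrite ?cT // inE iU.
  apply: (dim_upper_bound_leq _ hk) => //.
  by apply: leq_trans Rm; apply: subset_leq_card; apply: finset.subsetDl.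
- by rewrite -VE dim_restriction.
- have := griesmer_bound Td.
  have : (#|U :|: R| = #|U| + #|T|)%N.
    rewrite cardsU cardsD (finset.setIC R U).
    have := subset_leq_card (finset.subsetIr U R); lia.
  lia.
Qed.

(** Strong induction on the dimension [m] of the shortened code. The invariant says that each
    dimension lost so far has cost at least [griesmer #|F| kappa delta / kappa] coordinates. *)
Lemma LRC_greedy (F : finFieldType) (n k d r delta kappa : nat)
    (C : {vspace 'rV[F]_n}) :
  dim_upper_bound #|F| (r + delta - 1) delta kappa ->
  is_LRC C k d r delta ->
  exists U : {set 'I_n}, (0 < \dim (shorten C U) <= kappa)%N /\
   (k%:Z - (\dim (shorten C U))%:Z) * griesmer #|F| kappa delta
     <= kappa%:Z * #|U|%:Z.
Proof.
move=> hk hC; have q0 : (0 < #|F|)%N by apply/card_gt0P; exists 0.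
suff H m (U : {set 'I_n}) : \dim (shorten C U) = m -> (0 < m)%N ->
   (k%:Z - m%:Z) * griesmer #|F| kappa delta <= kappa%:Z * #|U|%:Z ->
   exists U : {set 'I_n}, (0 < \dim (shorten C U) <= kappa)%N /\
   (k%:Z - (\dim (shorten C U))%:Z) * griesmer #|F| kappa delta
     <= kappa%:Z * #|U|%:Z.
  have [dimC k0 _ _] := hC.
  have U0 : \dim (shorten C finset.set0) = k.
    rewrite -dimC; congr (\dim _); apply/vspaceP => u; rewrite mem_shorten.
    by rewrite andb_idr // => _; apply/coord_map_eq0 => i; rewrite inE.
  by apply: (H k finset.set0) => //; rewrite subrr mul0r cards0 mulr0.
elim/ltn_ind: m U => m IH U dimU m0 hU.
have [mk|km] := leqP m kappa; first by exists U; rewrite dimU m0 mk.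
have D0 : (0 < \dim (shorten C U))%N by rewrite dimU.
have [V [s [/andP[s0 sk] dimV cardV]]] := LRC_step hk hC D0.
have ratio := griesmer_ratio delta q0 sk.
(* As [s <= kappa < m], the dimension drops but stays positive. *)
apply: (IH (m - s)%N _ V); [lia|lia|lia|].
have -> : (m - s)%:Z = m%:Z - s%:Z by lia.
nia.
Qed.

(** A nonzero word of the final shortened code has weight at least [d] and vanishes on [U], so
    [#|U| <= n - d]. The remaining dimension, at most [kappa], is the additive loss. *)
Lemma LRC_bound (F : finFieldType) (n k d r delta kappa : nat)
    (C : {vspace 'rV[F]_n}) :
  (0 < delta)%N ->
  dim_upper_bound #|F| (r + delta - 1) delta kappa ->
  is_LRC C k d r delta ->
  [/\ (0 < n)%N, 0 < griesmer #|F| kappa delta &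
    (k%:Z - kappa%:Z) * griesmer #|F| kappa delta
     <= kappa%:Z * (n%:Z - d%:Z)].
Proof.
move=> delta0 hk hC.
have [U [/andP[D0 Dk] hU]] := LRC_greedy hk hC.
have [_ _ [/min_dist_geP Cd _] _] := hC.
(* Positivity of [kappa] comes from [0 < \dim (shorten C U) <= kappa]. *)
have G0 : 0 < griesmer #|F| kappa delta.
  by apply: griesmer_gt0 => //; apply: leq_trans Dk.
set D := shorten C U in D0 Dk hU.
have c0 : vpick D != 0 by rewrite vpick0 -dimv_eq0 -lt0n.
have := memv_pick D; rewrite mem_shorten => /andP[cC /coord_map_eq0 cU].
set c := vpick D in c0 cC cU.
have wd := Cd c cC c0.
have [i ci] : exists i, c 0 i != 0 by apply/rV0Pn.
have wU : (weight c <= #|~: U|)%N.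
  apply: subset_leq_card; apply/fintype.subsetP => j; rewrite !inE /=.
  by apply: contraNN => /cU ->.
have nE : (#|U| + #|~: U| = n)%N by rewrite cardsC card_ord.
split=> //; first by have := ltn_ord i; lia.
have : #|U|%:Z <= n%:Z - d%:Z by lia.
nia.
Qed.

(** * The asymptotic form of the bound *)

Local Open Scope classical_set_scope.
Local Open Scope ring_scope.

Theorem mainTheorem8 (R : realType) (q r delta kappaB : nat)
    (hq : prime_power q) (hr : (0 < r)%N) (hdelta : (0 < delta)%N)
    (hkappaB : dim_upper_bound q (r + delta - 1) delta kappaB) :
  exists eps : nat -> R,
    (eps n @[n --> \oo] --> (0 : R)) /\
    forall (F : finFieldType) (n k d : nat) (C : {vspace 'rV[F]_n}),
      #|F| = q ->
      is_LRC C k d r delta ->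
      k%:R / n%:R <=
        kappaB%:R / (griesmer q kappaB delta)%:~R * (1 - d%:R / n%:R) + eps n.
Proof.
(* The error is the additive loss [kappaB] divided by [n]. *)
exists (fun n => kappaB%:R * n%:R^-1); split.
  rewrite -(mulr0 kappaB%:R); apply: cvgMr.
  apply/gtr0_cvgV0; last exact: cvgr_idn.
  by near=> n; rewrite ltr0n; near: n; exists 1%N.
move=> F n k d C Fq hC; rewrite -Fq in hkappaB *.
have [n0 G0 h] := LRC_bound hdelta hkappaB hC.
move: G0 h; set G := griesmer _ _ _ => G0 h.
have n0R : 0 < n%:R :> R by rewrite ltr0n.
have G0R : 0 < G%:~R :> R by rewrite ltr0z.
have hR : (k%:R - kappaB%:R) * G%:~R <= kappaB%:R * (n%:R - d%:R) :> R.
  by move: h; rewrite -(ler_int R) !rmorphM !rmorphB.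
rewrite -subr_ge0.
have -> : kappaB%:R / G%:~R * (1 - d%:R / n%:R) + kappaB%:R / n%:R - k%:R / n%:R
  = (kappaB%:R * (n%:R - d%:R) - (k%:R - kappaB%:R) * G%:~R)
    / (G%:~R * n%:R) :> R.
  by field; rewrite !gt_eqF.
by rewrite divr_ge0 ?subr_ge0 // mulr_ge0 // ltW.
Unshelve. all: by end_near.
Qed.
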